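(* Let $X$ be a finite simple affine latin cycle set. Then $\mathrm{Dis}(X)$ is an elementary abelian $p$-group of size $p^k$ for some prime number $p$ dividing $k$.
   Context: A left quasigroup $(X,\cdot)$ is a non-empty set with a binary operation such that $\sigma_x:y\mapsto x\cdot y$ is bijective for every $x$; it is latin if moreover $y\mapsto y\cdot x$ is bijective for every $x$. A cycle set is a left quasigroup with $(x\cdot y)\cdot(x\cdot z)=(y\cdot x)\cdot(y\cdot z)$ for all $x,y,z$; all cycle sets are assumed non-degenerate, i.e. $x\mapsto x\cdot x$ is bijective. A latin cycle set is affine if it is (isomorphic to) one on an abelian group $(G,+)$ with $x\cdot y=\phi(x)+\psi(y)+c$ for some $\phi,\psi\in\mathrm{Aut}(G,+)$ and $c\in G$. $\mathcal{G}(X)=\langle\sigma_x\mid x\in X\rangle\le \mathrm{Sym}(X)$; $X$ is indecomposable if $\mathcal{G}(X)$ is transitive on $X$. The displacement group $\mathrm{Dis}(X)$ is the normal closure of $\{\sigma_x\sigma_y^{-1}\mid x,y\in X\}$ in $\mathcal{G}(X)$. A congruence is an equivalence relation $\sim$ such that $x\sim x'$ and $y\sim y'$ imply $x\cdot y\sim x'\cdot y'$ and $\sigma_x^{-1}(y)\sim\sigma_{x'}^{-1}(y')$. $X$ is simple if it is indecomposable and its only congruences are the equality relation and the all relation. *)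

(* Defs.v *)
From HB Require Import structures.
From mathcomp Require Import all_boot all_order all_algebra all_fingroup all_solvable.

Set Implicit Arguments.
Unset Strict Implicit.
Unset Printing Implicit Defensive.

Import GRing.Theory.

Record leftQuasigroup (X : finType) := LeftQuasigroup {
  lmul :> X -> X -> X;
  lmul_bij : forall x, bijective (lmul x);
  lmul_nonempty : 0 < #|X|
}.

Section FiniteLeftQuasigroups.
Variables (X : finType) (Q : leftQuasigroup X).

Definition latin : Prop := forall x, bijective (fun y => Q y x).

(* Non-degeneracy is part of the notion of cycle set. *)
Definition cycle_set : Prop :=
  (forall x y z, Q (Q x y) (Q x z) = Q (Q y x) (Q y z)) /\
  bijective (fun x => Q x x).

Definition affine : Prop :=
  exists (G : zmodType) (phi psi : {additive G -> G}) (c : G) (f : X -> G),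
    [/\ bijective phi, bijective psi, bijective f &
        forall x y, f (Q x y) = (phi (f x) + psi (f y) + c)%R].

Definition sigma (x : X) : {perm X} := perm (bij_inj (lmul_bij Q x)).

Definition perm_group : {group {perm X}} := <<[set sigma x | x : X]>>%G.

Definition indecomposable : bool := [transitive perm_group, on [set: X] | 'P].

(* The product s * t of {perm X} applies s first, so the composite
   sigma_x o (sigma_y)^-1 is written (sigma y)^-1 * sigma x. *)
Definition displacements : {set {perm X}} :=
  [set ((sigma y)^-1 * sigma x)%g | x : X, y : X].

Definition Dis : {group {perm X}} :=
  <<class_support displacements perm_group>>%G.

Definition congruence (R : rel X) : Prop :=
  equivalence_rel R /\
  forall x x' y y', R x x' -> R y y' ->
    R (Q x y) (Q x' y') /\ R ((sigma x)^-1%g y) ((sigma x')^-1%g y').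

Definition simple_lq : Prop :=
  indecomposable /\
  forall R : rel X, congruence R -> R =2 eq_op \/ R =2 (fun _ _ => true).

End FiniteLeftQuasigroups.

(* Main.v *)
Require Import Defs.
From HB Require Import structures.
From mathcomp Require Import all_boot all_order all_algebra all_fingroup all_solvable.
From mathcomp Require Import mxabelem.

(* Write x . y = phi x + psi y + c on the abelian group V.  The cycle set
   identity says phi psi - psi phi = phi^2.  Multiples of a prime give an
   invariant subgroup {v | p v = 0}, hence a congruence, so simplicity forces V
   to be elementary abelian; say V = (F_p)^k.  Then psi phi^-1 - phi^-1 psi = 1
   as k x k matrices over F_p, and taking traces gives k = 0 in F_p.  Finally
   sigma_x sigma_y^-1 is the translation by phi (x - y), so the displacement
   group is the group of all translations of V. *)

Import GRing.Theory FinRing.Theory.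

Set Implicit Arguments.
Unset Strict Implicit.
Unset Printing Implicit Defensive.

Local Open Scope ring_scope.

(** Every scalar of ['F_p] is a natural multiple of 1, so additivity already gives linearity. *)
Lemma mul_rV_additive (p m n : nat)
    (g : {additive 'rV['F_p]_m -> 'rV['F_p]_n}) (u : 'rV['F_p]_m) :
  u *m lin1_mx g = g u.
Proof.
have gZ : scalable g.
  by move=> a v; rewrite -[a]natr_Zp !scaler_nat raddfMn.
pose gS := GRing.isScalable.Build _ _ _ _ g gZ.
pose gL : {linear 'rV['F_p]_m -> 'rV['F_p]_n} := HB.pack (g : _ -> _) g gS.
exact: (mul_rV_lin1 gL).
Qed.

Lemma commutator_one_natr (R : comNzRingType) (n : nat) (A B : 'M[R]_n) :
  A *m B - B *m A = 1%:M -> n%:R = 0 :> R.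
Proof.
by move/(congr1 mxtrace); rewrite raddfB /= mxtrace_mulC subrr mxtrace1.
Qed.

Lemma dvdn_rV_commutator_sqr (p n : nat)
    (f g : {additive 'rV['F_p]_n -> 'rV['F_p]_n}) :
    prime p -> injective f -> (forall u, f (g u) = g (f u) + f (f u)) ->
  (p %| n)%N.
Proof.
move=> p_pr f_inj fgE; set F := lin1_mx f; set G := lin1_mx g.
have uF : F \in unitmx.
  rewrite -row_free_unit -kermx_eq0; apply/rowV0P => u /sub_kermxP.
  by rewrite mul_rV_additive -{1}(raddf0 f) => /f_inj.
(* Matrices act on row vectors from the right, so products come in the order opposite to
   composition. *)
have FG : G *m F = F *m G + F *m F.
  apply/row_matrixP => i; rewrite !rowE mulmxDr !mulmxA.
  by rewrite !mul_rV_additive fgE.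
have /commutator_one_natr/eqP : invmx F *m G - G *m invmx F = 1%:M.
  apply: (can_inj (mulmxK uF)).
  apply: (can_inj (mulKmx uF)).
  rewrite mulmxBl !mulmxBr !mulmxA mulmxV // mul1mx FG mulmxKV //.
  by rewrite mulmx1 addrC addKr.
by rewrite -(dvdn_pcharf (pchar_Fp p_pr)).
Qed.

Lemma abelem_zmod (V : finZmodType) (p : nat) :
  prime p -> (forall v : V, v *+ p = 0) -> (p.-abelem [set: V])%g.
Proof.
move=> p_pr pV0; apply/(abelemP p_pr); split=> [|v _]; first exact: zmod_abelian.
by rewrite zmodXgE pV0.
Qed.

Lemma dvdn_logn_commutator_sqr (V : finZmodType) (p : nat)
    (f g : {additive V -> V}) :
    prime p -> (forall v : V, v *+ p = 0) -> injective f ->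
    (forall v, f (g v) = g (f v) + f (f v)) ->
  (p %| logn p #|V|)%N.
Proof.
move=> p_pr pV0 f_inj fgE.
have abV := abelem_zmod p_pr pV0.
(* Coordinates in row vectors need a nontrivial group; for trivial [V] the logarithm is 0. *)
have [V1 | ntV] := eqVneq [set: V] 1%g.
  by rewrite -cardsT V1 cards1 logn1.
rewrite -cardsT -(dim_abelemE abV ntV).
pose r := abelem_rV abV ntV; pose s := rVabelem abV ntV.
have rK : cancel r s by move=> v; rewrite /r /s abelem_rV_K ?inE.
have sD : {morph s : u v / u + v} by move=> u v; rewrite /s rVabelemD.
have rD : {morph r : u v / u + v} by move=> u v; rewrite /r -abelem_rV_M ?inE.
have conjB (h : {additive V -> V}) : zmod_morphism (r \o h \o s).
  (* [r] and [s] are known to respect sums only, so the difference is moved to the other side. *)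
  move=> u v /=; apply: (addIr (r (h (s v)))).
  by rewrite subrK -rD -raddfD -sD subrK.
pose f1 := GRing.isZmodMorphism.Build _ _ _ (conjB f).
pose f2 : {additive _ -> _} := HB.pack (r \o f \o s) f1.
pose g1 := GRing.isZmodMorphism.Build _ _ _ (conjB g).
pose g2 : {additive _ -> _} := HB.pack (r \o g \o s) g1.
apply: (@dvdn_rV_commutator_sqr p _ f2 g2) => // [u v /= | u /=].
  by move/(can_inj rK)/f_inj; apply: rVabelem_inj.
by rewrite !rK fgE rD.
Qed.

Definition affine_form (X : finType) (Q : leftQuasigroup X) (V : zmodType)
    (phi psi : V -> V) (c : V) (f : X -> V) : Prop :=
  forall x y, f (Q x y) = phi (f x) + psi (f y) + c.

(** The bijection with [X] carries finiteness over to the abelian group, which opens the way to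
    Cauchy's theorem and to orders of groups. *)
Lemma affine_finZmod (X : finType) (Q : leftQuasigroup X) :
  affine Q ->
  exists (V : finZmodType) (phi psi : {additive V -> V}) (c : V) (f : X -> V),
    [/\ bijective phi, bijective psi, bijective f & affine_form Q phi psi c f].
Proof.
case=> V [phi [psi [c [f [phi_bij psi_bij [g fK gK] fE]]]]].
pose Vc := CanIsCountable gK.
pose VC : countType := HB.pack (GRing.Zmodule.sort V) V Vc.
pose Vf := @CanIsFinite VC X g f gK.
pose W : finZmodType := HB.pack (GRing.Zmodule.sort V) V Vc Vf.
by exists W, phi, psi, c, f; split=> //; exists g.
Qed.

Section AffineForm.
Variables (X : finType) (Q : leftQuasigroup X) (V : finZmodType).
Variables (phi psi : {additive V -> V}) (c : V) (f : X -> V) (g : V -> X).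
Hypotheses (phi_bij : bijective phi) (psi_inj : injective psi).
Hypotheses (fK : cancel f g) (gK : cancel g f).
Hypothesis fE : affine_form Q phi psi c f.

Lemma affine_cycle_set_commutator :
  cycle_set Q -> forall v, phi (psi v) = psi (phi v) + phi (phi v).
Proof.
(* With two arguments at 0, all terms in [c] cancel and only the linear parts at [v] remain. *)
case=> cycQ _ v; have /(congr1 f) := cycQ (g v) (g 0) (g 0).
rewrite !fE !gK !raddf0 !add0r !addr0 !raddfD => /addIr.
by rewrite addrACA -(addrA (phi (psi v))) => /addIr <-; rewrite addrC.
Qed.

Lemma f_sigmaV x y : psi (f ((sigma Q x)^-1%g y)) = f y - phi (f x) - c.
Proof.
rewrite -{2}(permKV (sigma Q x) y) [sigma Q x _]permE fE.
by rewrite [RHS]addrAC addrK addrAC subrr add0r.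
Qed.

Lemma torsion_congruence (p : nat) :
  congruence Q (fun x y => (f x - f y) *+ p == 0).
Proof.
split=> [x y z | x x' y y' /eqP xx' /eqP yy'].
  split=> [|/eqP xy0]; first by rewrite subrr mul0rn.
  by rewrite -(subrKA (f y) (f x)) mulrnDl xy0 add0r.
have E : phi (f x - f x') *+ p = 0 by rewrite -raddfMn xx' raddf0.
have F : psi (f y - f y') *+ p = 0 by rewrite -raddfMn yy' raddf0.
split; apply/eqP.
  by rewrite !fE opprD addrACA subrr addr0 opprD addrACA -!raddfB mulrnDl E F addr0.
(* Left division has a formula only after applying [psi], and the injective [psi] reflects
   [p]-torsion. *)
apply: psi_inj; rewrite raddf0 raddfMn raddfB !f_sigmaV.
rewrite opprD addrACA subrr addr0 opprD addrACA -opprD -raddfB.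
by rewrite mulrnDl yy' mulNrn E oppr0 addr0.
Qed.

Lemma simple_prime_exponent :
  simple_lq Q -> exists2 p : nat, prime p & forall v : V, v *+ p = 0.
Proof.
case=> _ congQ.
have [V1 | ntV] := eqVneq [set: V] 1%g.
  (* Any prime would do here. *)
  exists 2%N => // v; have : v \in [set: V] by rewrite inE.
  by rewrite V1 => /set1gP ->; rewrite zmod1gE mul0rn.
have p_pr : prime (pdiv #|[set: V]|) by rewrite pdiv_prime ?cardG_gt1.
set p := pdiv _ in p_pr.
have [v _ ov] := Cauchy p_pr (pdiv_dvd #|[set: V]|).
exists p => // w.
(* The element [v] of order [p] is congruent to 0, which excludes equality; the full relation makes
   every [w] congruent to 0. *)
have [/(_ (g v) (g 0)) | /(_ (g w) (g 0))] := congQ _ (torsion_congruence p).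
  rewrite !gK subr0 -zmodXgE -ov expg_order eqxx => /esym/eqP/(can_inj gK) v0.
  by move: p_pr; rewrite -/p -ov v0 order1.
by rewrite !gK subr0 => /eqP.
Qed.

Lemma transl_inj (v : V) : injective (fun x => g (f x + v)).
Proof. by move=> x y /(can_inj gK)/addIr/(can_inj fK). Qed.

Definition transl (v : V) : {perm X} := perm (@transl_inj v).

Lemma f_transl v x : f (transl v x) = f x + v.
Proof. by rewrite permE gK. Qed.

Lemma translM : {in [set: V] &, {morph transl : u v / (u * v)%g}}.
Proof.
move=> u v _ _; apply/permP => x; apply: (can_inj fK).
by rewrite permM !f_transl zmodMgE addrA.
Qed.
Canonical transl_morphism := Morphism translM.

Lemma injm_transl : ('injm transl)%g.
Proof.
apply/injmP => u v _ _ /permP/(_ (g 0))/(congr1 f).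
by rewrite !f_transl => /addrI.
Qed.

Lemma sigmaV_sigma x y :
  ((sigma Q y)^-1 * sigma Q x)%g = transl (phi (f x - f y)).
Proof.
apply/permP => z; apply: (can_inj fK).
rewrite permM f_transl [sigma Q x _]permE fE f_sigmaV raddfB.
by rewrite -addrA subrK addrCA.
Qed.

Lemma perm_group_norm_transl : (perm_group Q \subset 'N(transl @* [set: V]))%g.
Proof.
rewrite gen_subG; apply/subsetP => _ /imsetP[w _ ->].
rewrite inE; apply/subsetP => _ /imsetP[_ /morphimP[v _ _ ->] ->].
(* In the coordinate [f], [sigma Q w] is an affine map with linear part [psi]. *)
suff -> : (transl v ^ sigma Q w)%g = transl (psi v) by rewrite mem_morphim ?inE.
apply/permP => z; apply: (can_inj fK).
rewrite !permM f_transl [sigma Q w _]permE fE f_transl raddfD f_sigmaV.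
by rewrite [_ - c + _]addrAC addrA subrK addrA [phi _ + _]addrC subrK.
Qed.

Lemma Dis_transl : Dis Q = (transl @* [set: V])%g :> {set {perm X}}.
Proof.
apply/eqP; rewrite eqEsubset gen_subG; apply/andP; split.
  apply: class_support_sub_norm perm_group_norm_transl.
  apply/subsetP => _ /imset2P[x y _ _ ->].
  by rewrite sigmaV_sigma mem_morphim ?inE.
apply/subsetP => _ /morphimP[v _ _ ->].
have [phiV phiK phiVK] := phi_bij.
apply/mem_gen/(subsetP (sub_class_support _ _)).
(* As [phi] is onto, each translation is a single displacement, so this inclusion needs no products
   or conjugates. *)
apply/imset2P; exists (g (phiV v)) (g 0) => //.
by rewrite sigmaV_sigma !gK subr0 phiVK.
Qed.

End AffineForm.

Local Close Scope ring_scope.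

Theorem proposition49 (X : finType) (Q : leftQuasigroup X)
    (Q_cycle_set : cycle_set Q) (Q_latin : latin Q)
    (Q_affine : affine Q) (Q_simple : simple_lq Q) :
  exists p k : nat,
    [/\ prime p, (p.-abelem (Dis Q))%g, #|Dis Q| = (p ^ k)%N & p %| k].
Proof.
have [V [phi [psi [c [f [phi_bij psi_bij [g fK gK] fE]]]]]] :=
  affine_finZmod Q_affine.
have psi_inj := bij_inj psi_bij.
have [p p_pr pV0] := simple_prime_exponent psi_inj gK fE Q_simple.
have abV := abelem_zmod p_pr pV0.
have injT := injm_transl fK gK.
(* The injective morphism [transl] transfers order and exponent from [V] to [Dis Q]. *)
exists p, (logn p #|V|); rewrite (Dis_transl phi_bij fK gK fE).
split=> //; first by rewrite injm_abelem.
  by rewrite card_injm // (card_pgroup (abelem_pgroup abV)) cardsT.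
apply: dvdn_logn_commutator_sqr p_pr pV0 (bij_inj phi_bij) _.
exact: affine_cycle_set_commutator gK fE Q_cycle_set.
Qed.
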